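(* Let $\alpha=\omega\nu$ with $\nu\ge1$ an ordinal. The linearly ordered space $R_\alpha|_{[0,1]}$ is continuous, i.e. every non-empty subset $S$ of $R_\alpha|_{[0,1]}$ has a smallest upper bound $\sup S$ and a greatest lower bound $\inf S$ in $R_\alpha|_{[0,1]}$.
   Context: For an ordinal $\alpha=\omega\nu$, $\nu\ge1$ (a nonzero limit ordinal), let $A_\alpha$ be the set of all transfinite sequences $X_{(0,\alpha)}=(X_{\alpha'})_{0\le\alpha'<\alpha}$ with $X_{\alpha'}\in\{0,1\}$, ordered lexicographically: $X_{(0,\alpha)}<Y_{(0,\alpha)}$ iff there is $\alpha'<\alpha$ with $X_{\alpha'}=0$, $Y_{\alpha'}=1$ and $X_\beta=Y_\beta$ for all $\beta<\alpha'$. Such a pair is called a pair of twins if in addition $X_\beta=1$ and $Y_\beta=0$ for all $\beta$ with $\alpha'<\beta<\alpha$. $R_\alpha|_{[0,1]}$ is the quotient set $A_\alpha/{\sim}$, where $\sim$ identifies the two members of each pair of twins, with the induced linear order. *)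

(* Defs.v *)
From HB Require Import structures.
From Stdlib Require Import Relation_Operators.
From mathcomp Require Import all_boot all_order.
From mathcomp Require Import generic_quotient.
From mathcomp Require Import boolp classical_sets wochoice.

Set Implicit Arguments.
Unset Strict Implicit.
Unset Printing Implicit Defensive.

Import Order.TTheory.
Local Open Scope order_scope.
Local Open Scope quotient_scope.

(* An ordinal is represented by a well-ordered type; its elements are the
   smaller ordinals. Equality of ordinals is equality of order types. *)
HB.mixin Record isWellOrder (d : Order.disp_t) T of Order.Total d T := {
  wo_le : well_order (<=%O : rel T)
}.

#[short(type="woType")]
HB.structure Definition WellOrder (d : Order.disp_t) :=
  { T of isWellOrder d T & Order.Total d T }.

Definition same_order_type (d d' : Order.disp_t)
    (A : porderType d) (B : porderType d') : Prop :=
  exists2 f : A -> B, bijective f & {mono f : x y / x <= y}.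

(* The product of omega by nu in the convention for which it is a limit
   ordinal: nu consecutive copies of omega, i.e. nu is the leading coordinate
   of the lexicographic order. *)
Definition omega_mul (d : Order.disp_t) (nu : woType d) : orderType _ :=
  (nu *l nat)%type.

(* An alias of alpha -> bool, whose own order in the library is pointwise.
   The digits 0 and 1 are false and true. *)
Definition binseq (d : Order.disp_t) (alpha : woType d) : Type := alpha -> bool.

HB.instance Definition _ (d : Order.disp_t) (alpha : woType d) :=
  Choice.on (binseq alpha).

Section LexicographicOrder.
Context {d : Order.disp_t} {alpha : woType d}.
Implicit Types (X Y Z : binseq alpha) (a b : alpha).

Definition binseq_lt X Y : Prop :=
  exists a, [/\ X a = false, Y a = true & forall b, b < a -> X b = Y b].

Definition binseq_ltb X Y : bool := `[< binseq_lt X Y >].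

Lemma binseq_lt_irr : irreflexive binseq_ltb.
Proof. by move=> X; apply/asboolPn => -[a [-> ]]. Qed.

Lemma binseq_lt_trans : transitive binseq_ltb.
Proof.
move=> Y X Z /asboolP[a [Xa Ya XY]] /asboolP[b [Yb Zb YZ]]; apply/asboolP.
have [ab|ba|abE] := ltgtP a b.
- exists a; split=> //; first by rewrite -YZ.
  by move=> c ca; rewrite XY// YZ// (lt_trans ca).
- exists b; split=> //; first by rewrite XY.
  by move=> c cb; rewrite XY ?YZ// (lt_trans cb).
- by move: Yb; rewrite -abE Ya.
Qed.

HB.instance Definition _ := Order.Lt_isPOrder.Build d (binseq alpha)
  binseq_lt_irr binseq_lt_trans.

Lemma binseq_ltP X Y : reflect (binseq_lt X Y) (X < Y).
Proof. exact: asboolP. Qed.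

Lemma binseq_le_total : total (<=%O : rel (binseq alpha)).
Proof.
move=> X Y; have [->|XY] := eqVneq X Y; first by rewrite lexx.
have [a XYa] : exists a, X a != Y a.
  apply: contrapT => XYn; move/eqP: XY; apply; apply/funext => a.
  by apply: contrapT => /eqP XYa; apply: XYn; exists a.
have [m [[mD mmin] _]] :=
  wo_le [pred b | X b != Y b] (ex_intro _ a XYa).
have XYm b : b < m -> X b = Y b.
  move=> bm; apply: contrapT => /eqP XYb.
  by have := mmin b XYb; rewrite leNgt bm.
move: mD; rewrite inE; case Xm: (X m); case Ym: (Y m) => // _; apply/orP.
- by right; apply/ltW/binseq_ltP; exists m; split=> // b /XYm.
- by left; apply/ltW/binseq_ltP; exists m; split.
Qed.

HB.instance Definition _ := Order.POrder_isTotal.Build d (binseq alpha)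
  binseq_le_total.

End LexicographicOrder.

Section Twins.
Context {d : Order.disp_t} {alpha : woType d}.
Implicit Types (X Y Z : binseq alpha) (a b : alpha).

Definition twins X Y : Prop :=
  exists a, [/\ X a = false, Y a = true, forall b, b < a -> X b = Y b &
                forall b, a < b -> X b = true /\ Y b = false].

(* The equivalence relation generated by the twin pairs; see twin_equivP for
   the case of a limit ordinal, where it identifies nothing else. *)
Definition twin_equiv X Y : Prop := clos_refl_sym_trans _ twins X Y.

Lemma twin_equivP X Y : (forall a, exists b, a < b) ->
  twin_equiv X Y <-> [\/ X = Y, twins X Y | twins Y X].
Proof.
move=> nomax; split=> [|[->|XY|YX]]; last 3 first.
- exact: rst_refl.
- exact: rst_step.
- by apply: rst_sym; apply: rst_step.
have mixF U V W : twins U V -> twins V W -> False.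
  move=> [a [_ _ _ UV]] [b [_ _ _ VW]].
  have [c] := nomax (Order.max a b); rewrite gt_max => /andP[ac bc].
  by have [_] := UV c ac; have [-> _] := VW c bc.
elim=> {X Y} [X Y XY|X|X Y _ [->|XY|XY]|X Y Z _ [->|XY|XY] _ [<-|YZ|YZ]].
- exact: Or32.
- exact: Or31.
- exact: Or31.
- exact: Or33.
- exact: Or32.
- exact: Or31.
- exact: Or32.
- exact: Or33.
- exact: Or32.
- by case: (mixF _ _ _ XY YZ).
- apply: Or31; move: XY YZ => [a [Xa Ya XY XYa]] [b [Zb Yb ZY ZYb]].
  have [ab|ba|abE] := ltgtP a b.
  + by have [_] := XYa _ ab; rewrite Yb.
  + by have [_] := ZYb _ ba; rewrite Ya.
  apply/funext => c; have [ca|ac|->] := ltgtP c a.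
  + by rewrite XY// ZY// -abE.
  + by have [-> _] := XYa _ ac; have [|-> _ //] := ZYb c; rewrite -abE.
  + by rewrite Xa abE Zb.
- exact: Or33.
- apply: Or31; move: XY YZ => [a [Ya Xa YX YXa]] [b [Yb Zb YZ YZb]].
  have [ab|ba|abE] := ltgtP a b.
  + by have [] := YXa _ ab; rewrite Yb.
  + by have [] := YZb _ ba; rewrite Ya.
  apply/funext => c; have [ca|ac|->] := ltgtP c a.
  + by rewrite -YX// -YZ// -abE.
  + by have [_ ->] := YXa _ ac; have [|_ -> //] := YZb c; rewrite -abE.
  + by rewrite Xa abE Zb.
- by case: (mixF _ _ _ YZ XY).
Qed.

Definition twin_eqb : rel (binseq alpha) := fun X Y => `[< twin_equiv X Y >].

Lemma twin_eqb_refl : reflexive twin_eqb.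
Proof. by move=> X; apply/asboolP; apply: rst_refl. Qed.

Lemma twin_eqb_sym : symmetric twin_eqb.
Proof. by move=> X Y; apply/asboolP/asboolP; apply: rst_sym. Qed.

Lemma twin_eqb_trans : transitive twin_eqb.
Proof. by move=> Y X Z /asboolP XY /asboolP YZ; apply/asboolP; apply: rst_trans YZ. Qed.

Canonical twin_equiv_rel :=
  EquivRel twin_eqb twin_eqb_refl twin_eqb_sym twin_eqb_trans.

Lemma twins_adjacent X Y Z : twins X Y -> X <= Z -> Z <= Y -> Z = X \/ Z = Y.
Proof.
move=> [a [Xa Ya XY XYa]]; rewrite le_eqVlt => /predU1P[->|XZ]; first by left.
rewrite le_eqVlt => /predU1P[->|ZY]; first by right.
move/binseq_ltP: (XZ) => [p [Xp Zp XZp]]; move/binseq_ltP: (ZY) => [q [Zq Yq ZYq]].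
exfalso; have [pa|ap|pE] := ltgtP p a.
- suff YZ : Y < Z by have := lt_trans YZ ZY; rewrite ltxx.
  apply/binseq_ltP; exists p; split=> //; first by rewrite -XY.
  by move=> b bp; rewrite -XY ?XZp// (lt_trans bp).
- by have [] := XYa _ ap; rewrite Xp.
- have [qa|aq|qE] := ltgtP q a.
  + by move: Zq; rewrite -XZp ?pE// XY// Yq.
  + by have [_] := XYa _ aq; rewrite Yq.
  + by move: Zp; rewrite pE -qE Zq.
Qed.

Lemma twin_equiv_convex X Y Z : twin_equiv X Y ->
  (X <= Z <= Y) || (Y <= Z <= X) -> twin_equiv X Z.
Proof.
move=> H; elim: H Z => {X Y} [X Y XY|X|X Y XY IH|X Y W XY IH1 YW IH2] Z.
- have XYlt : X < Y.
    by case: XY => a [? ? ? _]; apply/binseq_ltP; exists a; split.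
  move=> /orP[/andP[XZ ZY]|/andP[YZ ZX]].
    have [->|->] := twins_adjacent XY XZ ZY; first exact: rst_refl.
    exact: rst_step.
  by have := lt_le_trans XYlt (le_trans YZ ZX); rewrite ltxx.
- by rewrite orbb => /le_anti <-; apply: rst_refl.
- by rewrite orbC => /IH; apply: rst_trans; apply: rst_sym.
- move=> /orP[/andP[XZ ZW]|/andP[WZ ZX]]; have [ZY|/ltW YZ] := leP Z Y.
  + by apply: IH1; rewrite XZ ZY.
  + by apply: (rst_trans _ _ _ _ _ XY); apply: IH2; rewrite YZ ZW.
  + by apply: (rst_trans _ _ _ _ _ XY); apply: IH2; rewrite WZ ZY orbT.
  + by apply: IH1; rewrite YZ ZX orbT.
Qed.

End Twins.

Definition R01 (d : Order.disp_t) (alpha : woType d) : Type :=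
  {eq_quot (@twin_equiv_rel d alpha)}.

HB.instance Definition _ (d : Order.disp_t) (alpha : woType d) :=
  Choice.on (R01 alpha).
HB.instance Definition _ (d : Order.disp_t) (alpha : woType d) :=
  EqQuotient.on (R01 alpha).

Section QuotientOrder.
Context {d : Order.disp_t} {alpha : woType d}.
Implicit Types (X Y : binseq alpha) (u v w : R01 alpha).

Lemma R01_eqP X Y : \pi_(R01 alpha) X = \pi_(R01 alpha) Y <-> twin_equiv X Y.
Proof.
by rewrite (rwP eqP) eqmodE; split=> /asboolP.
Qed.

Definition R01_le u v : bool :=
  `[< exists X Y, [/\ \pi_(R01 alpha) X = u, \pi_(R01 alpha) Y = v & X <= Y] >].

Lemma R01_le_refl : reflexive R01_le.
Proof. by move=> u; apply/asboolP; exists (repr u), (repr u); rewrite reprK lexx. Qed.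

Lemma R01_le_anti : antisymmetric R01_le.
Proof.
move=> u v /andP[/asboolP[X [Y [<- <- XY]]] /asboolP[Y' [X' [YY' XX' YX']]]].
move/R01_eqP: YY' => YY'; move/R01_eqP: XX' => XX'; apply/R01_eqP.
have [le_YX'|lt_X'Y] := leP Y X'.
  by apply: twin_equiv_convex (rst_sym _ _ _ _ XX') _; rewrite XY le_YX'.
apply: rst_trans (rst_sym _ _ _ _ XX') _.
apply: (rst_trans _ _ _ Y'); last exact: YY'.
apply: rst_sym; apply: twin_equiv_convex YY' _.
by rewrite YX' (ltW lt_X'Y).
Qed.

Lemma R01_le_trans : transitive R01_le.
Proof.
move=> v u w /asboolP[X [Y [<- <- XY]]] /asboolP[Y' [Z [YY' <- YZ]]].
move/R01_eqP: YY' => YY'; apply/asboolP.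
have [XZ|ZX] := leP X Z; first by exists X, Z.
exists X, X; split=> //; apply/R01_eqP.
apply: (rst_trans _ _ _ Y').
  apply: rst_sym; apply: twin_equiv_convex YY' _.
  by rewrite XY (le_trans YZ (ltW ZX)).
by apply: twin_equiv_convex YY' _; rewrite YZ (le_trans (ltW ZX) XY).
Qed.

HB.instance Definition _ := Order.Le_isPOrder.Build d (R01 alpha)
  R01_le_refl R01_le_anti R01_le_trans.

Lemma R01_le_total : total (<=%O : rel (R01 alpha)).
Proof.
move=> u v; apply/orP; have [uv|vu] := leP (repr u) (repr v); [left|right];
  apply/asboolP.
- by exists (repr u), (repr v); rewrite !reprK.
- by exists (repr v), (repr u); rewrite !reprK (ltW vu).
Qed.

HB.instance Definition _ := Order.POrder_isTotal.Build d (R01 alpha)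
  R01_le_total.

End QuotientOrder.

(* Main.v *)
Require Import Defs.
From HB Require Import structures.
From mathcomp Require Import all_boot all_order boolp classical_sets wochoice.
From mathcomp Require Import generic_quotient.
Local Open Scope classical_set_scope.

(** The lexicographic order on all 0-1 sequences of length alpha is already
complete: the supremum of T has digit 1 at a exactly when some member of T
with digit 1 at a has the lexicographically largest initial segment up to and
including a. Sending each class to a fixed representative is monotone, so the
class of the supremum of the representatives is a supremum in the quotient,
and infima are suprema of lower bounds. *)

Import Order.TTheory.
Local Open Scope order_scope.
Local Open Scope quotient_scope.

Section BinseqSup.
Context {d : Order.disp_t} {alpha : woType d}.
Implicit Types (T : set (binseq alpha)) (X Y Z : binseq alpha) (a b : alpha).

Definition first_increase X Y a : Prop :=
  [/\ X a = false, Y a = true & forall b, b < a -> X b = Y b].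

Definition segment_max T X a : Prop :=
  forall Y b, T Y -> b <= a -> ~ first_increase X Y b.

(** Digit 0 also serves as the default at positions where no member of [T] attains a largest
    segment. *)
Definition binseq_sup T : binseq alpha :=
  fun a => `[< exists X, [/\ T X, X a & segment_max T X a] >].

(** A difference at [b] would put the first difference inside both segments, so the smaller sequence
    would not be maximal there. *)
Lemma segment_max_eq T X Y a b : T X -> T Y ->
  segment_max T X a -> segment_max T Y b -> b <= a -> X b = Y b.
Proof.
move=> TX TY Xmax Ymax ba.
have first_le U V e : first_increase U V e -> U b != V b -> e <= b.
  move=> [_ _ UV]; rewrite leNgt; apply: contraNN => /UV ->; exact: eqxx.
apply: contrapT => /eqP XYb; have [XY|YX|XY] := ltgtP X Y.
- have [e XYe] := binseq_ltP _ _ XY.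
  by apply: (Xmax Y e TY _ XYe); rewrite (le_trans (first_le _ _ _ XYe XYb)).
- have [e YXe] := binseq_ltP _ _ YX.
  by apply: (Ymax X e TX _ YXe); apply: first_le YXe _; rewrite eq_sym.
- by move: XYb; rewrite XY eqxx.
Qed.

Lemma binseq_sup_ub T : ubound T (binseq_sup T).
Proof.
move=> Y TY; rewrite leNgt; apply/negP => /binseq_ltP[a [Za Ya ZY]].
pose P b := `[< exists2 W, T W & first_increase Y W b >].
have [c [ca Pc]] : exists c, c <= a /\ P c.
  apply: contrapT => noc; move/asboolPn: Za; apply.
  exists Y; split=> // W b TW ba YWb; apply: noc; exists b; split=> //.
  by apply/asboolP; exists W.
(* By minimality of [b], the segment of [W] up to [b] is largest: a member overtaking [W] earlier
   would overtake [Y] there too. *)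
have [b [[/asboolP[W TW [Yb Wb YW]] bmin] _]] := wo_le P (ex_intro _ c Pc).
have ba : b < a.
  rewrite lt_neqAle (le_trans (bmin c Pc) ca) andbT.
  by apply/eqP => abE; rewrite abE Ya in Yb.
suff: binseq_sup T b by rewrite ZY// Yb.
apply/asboolP; exists W; split=> // V e TV eb [We Ve WV].
have {}eb : e < b.
  by rewrite lt_neqAle eb andbT; apply/eqP => ebE; rewrite ebE Wb in We.
have : b <= e.
  apply: bmin; apply/asboolP; exists V => //; split=> //; first by rewrite YW.
  by move=> f fe; rewrite YW ?WV// (lt_trans fe).
by rewrite leNgt eb.
Qed.

Lemma binseq_sup_least T : lbound (ubound T) (binseq_sup T).
Proof.
move=> U TU; rewrite leNgt; apply/negP => /binseq_ltP[a [Ua Za UZ]].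
move/asboolP: Za => [X [TX Xa Xmax]].
have := TU X TX; rewrite le_eqVlt => /predU1P[XU|].
  by move: Xa; rewrite XU Ua.
move=> /binseq_ltP[c [Xc Uc XU]].
(* For [c < a], the supremum has digit 1 at [c], and its witness [W] must agree there with [X],
   whose digit is 0. *)
have [ca|ac|caE] := ltgtP c a; last by rewrite caE Ua in Uc.
- move: Uc; rewrite UZ// => /asboolP[W [TW Wc Wmax]].
  by rewrite -(segment_max_eq _ _ _ _ _ TX TW Xmax Wmax (ltW ca)) Xc in Wc.
- by rewrite XU// Ua in Xa.
Qed.

End BinseqSup.

Section R01Complete.
Context {d : Order.disp_t} {alpha : woType d}.
Implicit Types (X Y : binseq alpha) (u v : R01 alpha) (S : set (R01 alpha)).

Lemma le_pi_R01 X Y : X <= Y -> \pi_(R01 alpha) X <= \pi_(R01 alpha) Y.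
Proof. by move=> XY; apply/asboolP; exists X, Y. Qed.

(** Representatives in strictly reversed order would project to [v <= u], forcing [u = v]. *)
Lemma le_repr_R01 u v : u <= v -> repr u <= repr v.
Proof.
move=> uv; rewrite leNgt; apply/negP => vu.
have := le_pi_R01 _ _ (ltW vu); rewrite !reprK => le_vu.
have uvE : u = v by apply/le_anti; rewrite uv.
by rewrite uvE ltxx in vu.
Qed.

Lemma R01_supremum S : exists s, supremums S s.
Proof.
exists (\pi_(R01 alpha) (binseq_sup [set repr u | u in S])); split=> [u Su|v Sv].
  rewrite -[u]reprK; apply/le_pi_R01/binseq_sup_ub; by exists u.
rewrite -[v]reprK; apply/le_pi_R01/binseq_sup_least => _ [u Su <-].
exact/le_repr_R01/Sv.
Qed.

Lemma R01_infimum S : exists i, infimums S i.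
Proof.
have [i [i_ub i_least]] := R01_supremum (lbound S).
(* Each element of [S] is an upper bound of [lbound S], hence lies above [i]. *)
by exists i; split=> // u Su; apply: i_least => v; apply.
Qed.

End R01Complete.

Theorem theorem5 (d d' : Order.disp_t) (alpha : woType d) (nu : woType d')
    (nu_ge1 : inhabited nu) (alphaE : same_order_type alpha (omega_mul nu))
    (S : set (R01 alpha)) (S_neq0 : S !=set0) :
  (exists s : R01 alpha, supremums S s) /\
  (exists i : R01 alpha, infimums S i).
Proof. by split; [exact: R01_supremum|exact: R01_infimum]. Qed.
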